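(* Let $\mathcal{G}$ be a compact group acting continuously on a sample space $\mathcal{Y}$. A measurable function $\varepsilon : \mathcal{Y} \to [0,\infty]$ is an exact e-value for $\mathcal{G}$ invariance if and only if there exists a non-negative measurable statistic $T$ on $\mathcal{Y}$ (values in $[0,\infty]$) with $0 < \mathbb{E}_{\overline{G}}[T(\overline{G}y)] < \infty$ for every $y \in \mathcal{Y}$ such that $\varepsilon = \varepsilon_T$, where $$\varepsilon_T(y) = \frac{T(y)}{\mathbb{E}_{\overline{G}}[T(\overline{G}y)]}, \qquad \overline{G} \sim \mathrm{Unif}(\mathcal{G}).$$
   Context: All spaces are second-countable locally compact Hausdorff, equipped with their Borel $\sigma$-algebras. $\mathrm{Unif}(\mathcal{G})$ is the Haar probability measure on $\mathcal{G}$. A probability measure $\mathbb{P}$ on $\mathcal{Y}$ is $\mathcal{G}$ invariant if $\mathbb{P}(G^{-1}A) = \mathbb{P}(A)$ for all $G \in \mathcal{G}$ and all events $A$. An e-value $\varepsilon$ is exact for $\mathcal{G}$ invariance if $\mathbb{E}^{\mathbb{P}}[\varepsilon] = 1$ for every $\mathcal{G}$ invariant probability $\mathbb{P}$ on $\mathcal{Y}$. *)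

(* Defs.v *)
From HB Require Import structures.
From mathcomp Require Import all_boot all_order all_algebra.
From mathcomp Require Import all_classical all_reals all_analysis.

Set Implicit Arguments.
Unset Strict Implicit.
Unset Printing Implicit Defensive.

Local Open Scope classical_set_scope.
Local Open Scope ereal_scope.

HB.mixin Record PreTopologicalGroup_isTopologicalGroup G
    & Topological G & Group G := {
  mulg_continuous : continuous (fun x : G * G => (x.1 * x.2)%g) ;
  invg_continuous : continuous (fun x : G => (x^-1)%g)
}.

(* Measurable types of the library are pointed, hence the (arbitrary)
   distinguished point carried by topological groups here. *)
#[short(type="topologicalGroupType")]
HB.structure Definition TopologicalGroup :=
  {G of PointedTopological G & Group G
      & PreTopologicalGroup_isTopologicalGroup G}.

Notation borel T := (g_sigma_algebraType (@open T)).

Definition lcsch_space (T : topologicalType) : Prop :=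
  [/\ @second_countable T, locally_compact [set: T] & hausdorff_space T].

Record continuous_action (G : topologicalGroupType) (Y : topologicalType) :=
  ContinuousAction {
    act :> G -> Y -> Y ;
    act1 : forall y, act 1%g y = y ;
    actM : forall g h y, act (g * h)%g y = act g (act h y) ;
    act_continuous : continuous (fun p : G * Y => act p.1 p.2)
  }.

(* On a second-countable compact group, a left-invariant Borel probability
   measure is unique: it is the Haar probability measure, automatically regular
   and right invariant. *)
Definition is_haar_probability (R : realType) (G : topologicalGroupType)
    (mu : probability (borel G) R) : Prop :=
  forall (g : G) (A : set (borel G)), measurable A ->
    mu [set (g * h)%g | h in A] = mu A.

Definition invariant_probability (R : realType) (G : topologicalGroupType)
    (Y : ptopologicalType) (a : continuous_action G Y)
    (P : probability (borel Y) R) : Prop :=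
  forall (g : G) (A : set (borel Y)), measurable A ->
    P [set a (g^-1)%g y | y in A] = P A.

Definition exact_for_invariance (R : realType) (G : topologicalGroupType)
    (Y : ptopologicalType) (a : continuous_action G Y)
    (eps : borel Y -> \bar R) : Prop :=
  forall P : probability (borel Y) R, invariant_probability a P ->
    \int[P]_y eps y = 1.

Definition orbit_mean (R : realType) (G : topologicalGroupType)
    (Y : ptopologicalType) (mu : probability (borel G) R)
    (a : continuous_action G Y) (T : borel Y -> \bar R) (y : Y) : \bar R :=
  \int[mu]_g T (a g y).

Definition evalue_of (R : realType) (G : topologicalGroupType)
    (Y : ptopologicalType) (mu : probability (borel G) R)
    (a : continuous_action G Y) (T : borel Y -> \bar R) : borel Y -> \bar R :=
  fun y => T y / orbit_mean mu a T y.

(* Main.v *)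
From HB Require Import structures.
Require Import Defs.
From mathcomp Require Import all_boot all_order all_algebra.
From mathcomp Require Import all_classical all_reals all_analysis.
From mathcomp Require Import measurable_realfun.

(** An invariant probability averages over the orbits: exchanging the order of
    integration, the [P]-integral of a non-negative [f] equals the [P]-integral
    of its orbit mean [y |-> E f (G y)] ([integral_orbit_mean]). Conversely the
    law of [G y] is itself an invariant probability, for every [y]
    ([orbit_law_invariant]). Therefore [eps] is exact if and only if its orbit
    mean is identically [1].

    If it is, [T := eps] is its own normalisation. If [eps] is [T] divided by
    the orbit mean of [T], then, the orbit mean being constant along orbits
    ([orbit_mean_act]), the denominator comes out of the integral that defines
    the orbit mean of [eps] at [y], and what is left is
    [orbit_mean T y / orbit_mean T y = 1].

    Two facts support this. Constancy along orbits uses invariance of the Haar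
    probability under right translations; only left invariance is assumed, and
    the other one comes from a Fubini argument through invariance under
    inversion. Each use of Fubini needs [(g, y) |-> f (g y)] to be measurable
    for the product of the Borel sigma-algebras, whereas continuity gives it
    for the Borel sigma-algebra of the product topology; second countability
    makes the two agree ([measurable_open_prod]). *)

Import Order.TTheory.

Local Open Scope classical_set_scope.
Local Open Scope ereal_scope.

(** * Borel measurability of continuous maps *)

Lemma countable_bigcup_measurable {d : measure_display} {T : measurableType d}
    {I : Type} {D : set I} {F : I -> set T} :
  countable D -> (forall i, D i -> measurable (F i)) ->
  measurable (\bigcup_(i in D) F i).
Proof.
move=> cD mF; have [->|/set0P[i0 _]] := eqVneq D set0.
  by rewrite bigcup_set0.
have /countable_injP[f injf] := cD.
rewrite -(injpinv_image (cst i0) injf) bigcup_image.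
apply: bigcup_measurable => _ /= [i Di <-].
by rewrite pinvKV ?inE//; exact: mF.
Qed.

(** An open set of the product is the union of the basic open rectangles that it
    contains, and second countability makes this union countable. *)
Lemma measurable_open_prod {T1 T2 : ptopologicalType} :
  @second_countable T1 -> @second_countable T2 ->
  forall U : set (T1 * T2), open U ->
    measurable (U : set (borel T1 * borel T2)).
Proof.
move=> [B1 cB1 [oB1 nB1]] [B2 cB2 [oB2 nB2]] U oU.
pose D := [set p : set T1 * set T2 | (B1 `*` B2) p /\ p.1 `*` p.2 `<=` U].
have -> : U = \bigcup_(p in D) (p.1 `*` p.2).
  apply/seteqP; split=> [[x y] Uxy|[x y] [p [_ pU]]]; last exact: pU.
  have [[P Q] /= [nP nQ] PQU] : nbhs (x, y) U by exact: open_nbhs_nbhs.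
  have [V [B1V Vx] VP] := nB1 _ _ nP.
  have [W [B2W Wy] WQ] := nB2 _ _ nQ.
  exists (V, W) => //; split=> //= -[x' y'] [/= Vx' Wy'].
  by apply: PQU; split; [exact: VP|exact: WQ].
apply: countable_bigcup_measurable => [|[V W] [[/= B1V B2W] _]].
  apply: sub_countable (countableX cB1 cB2).
  by apply: subset_card_le => p [].
by apply: measurableX; apply: sub_sigma_algebra; [exact: oB1|exact: oB2].
Qed.

Lemma continuous_sectionl {S1 S2 T : topologicalType} {f : S1 * S2 -> T} x :
  continuous f -> continuous (fun y => f (x, y)).
Proof.
move=> cf y; apply: (@continuous_comp _ _ _ (pair x) f); last exact: cf.
by apply: cvg_pair; [exact: cvg_cst|exact: cvg_id].
Qed.

Lemma continuous_sectionr {S1 S2 T : topologicalType} {f : S1 * S2 -> T} y :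
  continuous f -> continuous (fun x => f (x, y)).
Proof.
move=> cf x; apply: (@continuous_comp _ _ _ (pair^~ y) f); last exact: cf.
by apply: cvg_pair; [exact: cvg_id|exact: cvg_cst].
Qed.

Lemma continuous_measurable_borel {S T : ptopologicalType} {f : S -> T} :
  continuous f -> measurable_fun [set: borel S] (f : borel S -> borel T).
Proof.
move=> /continuousP cf.
apply: (@measurability _ _ (borel S) (borel T) _ _ open) => //.
move=> _ [U oU <-]; rewrite setTI; apply: sub_sigma_algebra; exact: cf.
Qed.

Lemma continuous_measurable_borel_prod {S1 S2 T : ptopologicalType}
    {f : S1 * S2 -> T} :
  @second_countable S1 -> @second_countable S2 -> continuous f ->
  measurable_fun [set: borel S1 * borel S2]
    (f : borel S1 * borel S2 -> borel T).
Proof.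
move=> sS1 sS2 /continuousP cf.
apply: (@measurability _ _ _ (borel T) _ _ open) => //.
move=> _ [U oU <-]; rewrite setTI; apply: measurable_open_prod => //.
exact: cf.
Qed.

(** * Invariance of the Haar probability *)

Lemma ge0_integral_measure_preserving {d : measure_display}
    {T : measurableType d} {R : realType} {m : measure T R}
    {phi : T -> T} {f : T -> \bar R} :
  measurable_fun [set: T] phi ->
  (forall A, measurable A -> m (phi @^-1` A) = m A) ->
  measurable_fun [set: T] f -> (forall x, 0 <= f x) ->
  \int[m]_x f (phi x) = \int[m]_x f x.
Proof.
move=> mphi phim mf f0.
transitivity (\int[pushforward m phi]_x f x).
  by rewrite ge0_integral_pushforward.
by apply: eq_measure_integral => A mA _; exact: phim.
Qed.

Lemma integral_cst_probability {d : measure_display} {T : measurableType d}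
    {R : realType} (P : probability T R) (c : \bar R) : \int[P]_x c = c.
Proof.
transitivity (c * P [set: T]); first exact: integral_cst.
by rewrite probability_setT mule1.
Qed.

Section haar.
Context {R : realType} {G : topologicalGroupType}
  {mu : probability (borel G) R}.
Hypotheses (sG : @second_countable G) (hmu : is_haar_probability mu).

Lemma mulgl_continuous (g : G) : continuous (fun h : G => (g * h)%g).
Proof.
exact: (@continuous_sectionl G G G _ g (@mulg_continuous G)).
Qed.

Lemma mulgr_continuous (g : G) : continuous (fun h : G => (h * g)%g).
Proof.
exact: (@continuous_sectionr G G G _ g (@mulg_continuous G)).
Qed.

Lemma haar_preimage_mulgl (g : G) (A : set (borel G)) : measurable A ->
  mu [set h | A (g * h)%g] = mu A.
Proof.
move=> mA; rewrite -[RHS](hmu g^-1%g)//; congr (mu _).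
apply/seteqP; split=> [h Agh|_ [h Ah <-]]; last by rewrite /= mulVKg.
by exists (g * h)%g; rewrite ?mulKg.
Qed.

Lemma haar_integral_mulgl (g : G) (f : borel G -> \bar R) :
  measurable_fun [set: borel G] f -> (forall h, 0 <= f h) ->
  \int[mu]_h f (g * h)%g = \int[mu]_h f h.
Proof.
apply: (@ge0_integral_measure_preserving _ (borel G) _ mu (fun h => (g * h)%g)).
  by apply: continuous_measurable_borel; exact: mulgl_continuous.
by move=> A mA; exact: haar_preimage_mulgl.
Qed.

Lemma measurable_comp_invg {f : borel G -> \bar R} :
  measurable_fun [set: borel G] f ->
  measurable_fun [set: borel G] (fun h : borel G => f (h^-1)%g).
Proof.
move=> mf; have mV := @continuous_measurable_borel G G _ (@invg_continuous G).
exact: (measurableT_comp mf mV).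
Qed.

(** Integrate [f (h^-1 * g)] over [g] and [h]: integrating [g] first, left
    invariance leaves the integral of [f]; integrating [h] first in
    [(g^-1 * h)^-1] leaves the integral of [f] composed with inversion. *)
Lemma haar_integral_invg (f : borel G -> \bar R) :
  measurable_fun [set: borel G] f -> (forall h, 0 <= f h) ->
  \int[mu]_h f (h^-1)%g = \int[mu]_h f h.
Proof.
move=> mf f0.
have mfV := measurable_comp_invg mf.
have mfd : measurable_fun [set: borel G * borel G]
    (fun p : borel G * borel G => f (p.1^-1 * p.2)%g).
  apply: (measurableT_comp mf); apply: continuous_measurable_borel_prod => //.
  move=> [h g]; apply: (@continuous_comp _ _ _
    (fun p : G * G => (p.1^-1%g, p.2)) (fun p : G * G => (p.1 * p.2)%g));
    last exact: mulg_continuous.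
  apply: cvg_pair; last exact: cvg_snd.
  by apply: (@continuous_comp _ _ G fst _ (h, g));
    [exact: cvg_fst|exact: invg_continuous].
rewrite -[RHS](integral_cst_probability mu) -[LHS](integral_cst_probability mu).
transitivity (\int[mu]_g \int[mu]_h f (h^-1 * g)%g).
  apply: eq_integral => g _.
  rewrite -(haar_integral_mulgl g^-1%g)//.
  by apply: eq_integral => h _; rewrite invgM invgK.
rewrite -(fubini_tonelli (fun p : borel G * borel G => f (p.1^-1 * p.2)%g))//=.
by apply: eq_integral => h _; exact: haar_integral_mulgl.
Qed.

(** Inversion preserves the integral and turns right translations into left
    ones. *)
Lemma haar_integral_mulgr (g : G) (f : borel G -> \bar R) :
  measurable_fun [set: borel G] f -> (forall h, 0 <= f h) ->
  \int[mu]_h f (h * g)%g = \int[mu]_h f h.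
Proof.
move=> mf f0.
have mfV := measurable_comp_invg mf.
rewrite -[RHS]haar_integral_invg// -[RHS](haar_integral_mulgl g^-1%g)//.
rewrite -[LHS]haar_integral_invg//.
  by apply: eq_integral => h _; rewrite invgM invgK.
apply: (measurableT_comp mf).
exact: (@continuous_measurable_borel G G _ (mulgr_continuous g)).
Qed.

End haar.

(** * Orbits *)

Section action.
Context {R : realType} {G : topologicalGroupType} {Y : ptopologicalType}
  (a : continuous_action G Y).

Lemma actgK (g : G) : cancel (a g) (a g^-1%g).
Proof. by move=> y; rewrite -actM mulVg act1. Qed.

Lemma actgVK (g : G) : cancel (a g^-1%g) (a g).
Proof. by move=> y; rewrite -actM mulgV act1. Qed.

Lemma measurable_act (g : G) :
  measurable_fun [set: borel Y] (a g : borel Y -> borel Y).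
Proof.
apply: continuous_measurable_borel.
exact: (continuous_sectionl g (@act_continuous _ _ a)).
Qed.

Lemma measurable_orbit (y : Y) :
  measurable_fun [set: borel G] ((fun g => a g y) : borel G -> borel Y).
Proof.
apply: continuous_measurable_borel.
exact: (continuous_sectionr y (@act_continuous _ _ a)).
Qed.

Lemma invariant_probability_integral_act (P : probability (borel Y) R) (g : G)
    (f : borel Y -> \bar R) :
  invariant_probability a P ->
  measurable_fun [set: borel Y] f -> (forall y, 0 <= f y) ->
  \int[P]_y f (a g y) = \int[P]_y f y.
Proof.
move=> Pinv; apply: (@ge0_integral_measure_preserving _ (borel Y) _ P (a g)).
  exact: measurable_act.
move=> A mA; rewrite -[RHS](Pinv g)//; congr (P _).
apply/seteqP; split=> [y Agy|_ [y Ay <-]]; last by rewrite /= actgVK.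
by exists (a g y); rewrite ?actgK.
Qed.

Section orbit_mean.
Context {mu : probability (borel G) R}.
Hypotheses (sG : @second_countable G) (hmu : is_haar_probability mu).

Definition orbit_mfun (y : Y) : {mfun borel G >-> borel Y} :=
  HB.pack ((fun g => a g y) : borel G -> borel Y)
    (isMeasurableFun.Build _ _ _ _ _ (measurable_orbit y)).

(** Moving [A] by [g^-1] moves the set of the [h] with [h y] in [A] by left
    translation by [g^-1]. *)
Lemma orbit_law_invariant (y : Y) :
  invariant_probability a (distribution mu (orbit_mfun y)).
Proof.
move=> g A mA; rewrite /distribution /pushforward /=.
rewrite -[RHS](haar_preimage_mulgl hmu g); last first.
  by rewrite -[X in measurable X]setTI; exact: measurable_orbit.
congr (mu _); apply/seteqP; split=> [h [z Az zE]|h /= Agh].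
  by rewrite /= actM -[a h y]zE actgVK.
by exists (a (g * h)%g y) => //; rewrite actM actgK.
Qed.

(** Passing from [y] to [g y] is a right translation of the integration
    variable. *)
Lemma orbit_mean_act (T : borel Y -> \bar R) (g : G) (y : Y) :
  measurable_fun [set: borel Y] T -> (forall z, 0 <= T z) ->
  orbit_mean mu a T (a g y) = orbit_mean mu a T y.
Proof.
move=> mT T0; rewrite /orbit_mean.
rewrite -(haar_integral_mulgr sG hmu g (fun h : borel G => T (a h y)))//.
  by apply: eq_integral => h _; rewrite actM.
exact: measurableT_comp (measurable_orbit y).
Qed.

(** After the exchange of integrals the inner one is the [P]-integral of
    [f (g y)], which by invariance of [P] does not depend on [g]. *)
Lemma integral_orbit_mean (P : probability (borel Y) R)
    (f : borel Y -> \bar R) :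
  @second_countable Y -> invariant_probability a P ->
  measurable_fun [set: borel Y] f -> (forall y, 0 <= f y) ->
  \int[P]_y orbit_mean mu a f y = \int[P]_y f y.
Proof.
move=> sY Pinv mf f0; rewrite /orbit_mean.
have mfa : measurable_fun [set: borel G * borel Y]
    (fun p : borel G * borel Y => f (a p.1 p.2)).
  apply: (measurableT_comp mf); apply: continuous_measurable_borel_prod => //.
  exact: act_continuous.
rewrite -(fubini_tonelli (fun p : borel G * borel Y => f (a p.1 p.2)))//=.
rewrite -[RHS](integral_cst_probability mu).
by apply: eq_integral => g _; exact: invariant_probability_integral_act.
Qed.

(** The orbit mean of [T] may be taken out of the integral because it is
    constant on the orbit that is integrated over. *)
Lemma orbit_mean_evalue_of (T : borel Y -> \bar R) (y : Y) :
  measurable_fun [set: borel Y] T -> (forall z, 0 <= T z) ->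
  0 < orbit_mean mu a T y < +oo ->
  orbit_mean mu a (evalue_of mu a T) y = 1.
Proof.
move=> mT T0 /andP[m0 moo]; rewrite {1}/orbit_mean /evalue_of.
under eq_integral do rewrite orbit_mean_act//.
have mfin : orbit_mean mu a T y \is a fin_num by rewrite ge0_fin_numE// ltW.
rewrite ge0_integralZr//.
- by rewrite divee// gt_eqF.
- exact: measurableT_comp (measurable_orbit y).
- by rewrite inve_ge0 ltW.
Qed.

End orbit_mean.
End action.

Theorem theorem3 (R : realType) (G : topologicalGroupType)
    (Y : ptopologicalType) (a : continuous_action G Y)
    (hG : lcsch_space G) (cG : compact [set: G]) (hY : lcsch_space Y)
    (mu : probability (borel G) R) (hmu : is_haar_probability mu)
    (eps : borel Y -> \bar R) (meps : measurable_fun [set: borel Y] eps)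
    (eps_ge0 : forall y, 0 <= eps y) :
  exact_for_invariance a eps <->
  exists T : borel Y -> \bar R,
    [/\ measurable_fun [set: borel Y] T,
        forall y, 0 <= T y,
        forall y, 0 < orbit_mean mu a T y < +oo &
        eps = evalue_of mu a T].
Proof.
have [[sG _ _] [sY _ _]] := (hG, hY).
split=> [exact_eps|[T [mT T0 mean_T epsE]] P Pinv].
  have mean1 y : orbit_mean mu a eps y = 1.
    rewrite -(exact_eps _ (orbit_law_invariant a hmu y)).
    by rewrite ge0_integral_distribution.
  exists eps; split=> // [y|]; first by rewrite mean1 lte01 ltry.
  by apply/funext => y; rewrite /evalue_of mean1 inve1 mule1.
rewrite -(integral_orbit_mean a (mu := mu) sG P eps sY Pinv)//.
rewrite -[RHS](integral_cst_probability P).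
by apply: eq_integral => y _; rewrite epsE orbit_mean_evalue_of.
Qed.
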